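(* Let $\gamma,\beta,\mu>0$ be scalar design parameters, $\theta^*\in\mathbb{R}^N$ an unknown constant parameter, and $\phi(t)\in\mathbb{R}^N$, $t\ge t_0$, a time-varying feature. Put $\tilde\theta(t)=\theta(t)-\theta^*$, $e_y(t)=\tilde\theta(t)^T\phi(t)$ and $\mathcal{N}_t=1+\mu\,\phi(t)^T\phi(t)$, and consider the higher order algorithm $$\dot\vartheta=-\gamma\,\phi\, e_y,\qquad \dot\theta=-\beta(\theta-\vartheta)\,\mathcal{N}_t$$ for $(\vartheta(t),\theta(t))\in\mathbb{R}^N\times\mathbb{R}^N$, with arbitrary initial condition. Then $$V=\frac1\gamma\|\vartheta-\theta^*\|^2+\frac1\gamma\|\theta-\vartheta\|^2$$ is a Lyapunov function with time derivative $$\dot V\le -\frac{2\beta}{\gamma}\|\theta-\vartheta\|^2-\|e_y\|^2-\bigl[\|e_y\|-2\|\theta-\vartheta\|\,\|\phi\|\bigr]^2\le 0,$$ and therefore $(\vartheta-\theta^* )\in\mathcal{L}_\infty$ and $(\theta-\vartheta)\in\mathcal{L}_\infty$. If in addition it is assumed that $\phi,\dot\phi\in\mathcal{L}_\infty$, then $$\lim_{t\to\infty}e_y(t)=0,\quad \lim_{t\to\infty}(\theta(t)-\vartheta(t))=0,\quad \lim_{t\to\infty}\dot\vartheta(t)=0,\quad \lim_{t\to\infty}\dot{\tilde\theta}(t)=0.$$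
   Context: Time-varying regression: the known scalar output is $y(t)=\theta^{*T}\phi(t)$ with unknown constant parameter $\theta^*\in\mathbb{R}^N$ and known time-varying feature $\phi(t)\in\mathbb{R}^N$. The estimated output is $\hat y(t)=\theta(t)^T\phi(t)$, where $\theta(t)\in\mathbb{R}^N$ is the parameter estimate. The output error is $e_y=\hat y-y=\tilde\theta^T\phi\in\mathbb{R}$, with parameter estimation error $\tilde\theta=\theta-\theta^*$. The higher order algorithm is the pair of differential equations for $(\vartheta,\theta)$ in the claim, with scalar design parameters $\gamma,\beta>0$ and normalizing signal $\mathcal{N}_t$ containing a scalar $\mu>0$. Conventions: $\|\cdot\|$ is the 2-norm (absolute value for scalars). A function $f$ of time is in $\mathcal{L}_\infty$ if $\sup_t\|f(t)\|<\infty$ over the time interval considered. ''Lyapunov function'' means that $V$, as a function of the state $z=(\vartheta-\theta^*,\theta-\vartheta)$, is positive definite and decrescent (there are continuous non-decreasing scalar functions $\underline\alpha,\underline\beta$ vanishing at $0$ with $0<\underline\alpha(\|z\|)\le V\le\underline\beta(\|z\|)$ for $z\ne0$, and $V=0$ at $z=0$), and that its time derivative along solutions satisfies $\dot V\le0$.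
   Formalization: The design parameters are additionally assumed to satisfy μ ≥ 2γ/β; without this the stated bound on the time derivative of V is false (e.g. N=1, φ=1, θ*=0, γ=1, β=1/2, μ=1/4, ϑ=0, θ=1 gives a positive derivative 3/4). *)

(* Defs.v *)
From HB Require Import structures.
From mathcomp Require Import all_boot all_order all_algebra.
From mathcomp Require Import all_classical all_reals all_analysis.

Set Implicit Arguments.
Unset Strict Implicit.
Unset Printing Implicit Defensive.
Import Order.TTheory GRing.Theory Num.Theory.
Import numFieldNormedType.Exports.
Local Open Scope classical_set_scope.
Local Open Scope ring_scope.

Definition dotv (R : realType) (n : nat) (u v : 'cV[R]_n) : R :=
  (u^T *m v) 0 0.

(* The norm [`| u |] that MathComp-Analysis puts on matrices is the max norm,
   hence a separate definition of the 2-norm. *)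
Definition norm2 (R : realType) (n : nat) (u : 'cV[R]_n) : R :=
  Num.sqrt (dotv u u).

(* [l] is the derivative at [t] of [f] as a function on [t0, +oo[: two-sided
   for t > t0 and one-sided (right) at t = t0.  Values of [f] before [t0] play
   no role. *)
Definition is_deriv_from (R : realType) (V : normedModType R) (t0 : R)
    (f : R -> V) (t : R) (l : V) : Prop :=
  (s - t)^-1 *: (f s - f t) @[s --> within `[t0, +oo[ t^'] --> l.

Definition Linfty (R : realType) (n : nat) (t0 : R) (f : R -> 'cV[R]_n) : Prop :=
  has_ubound [set norm2 (f t) | t in `[t0, +oo[].

Definition pos_def_decrescent (R : realType) (n : nat) (V : 'cV[R]_n -> R) : Prop :=
  V 0 = 0 /\
  exists a b : R -> R,
    [/\ {within `[0, +oo[, continuous a} /\ {within `[0, +oo[, continuous b},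
        {in `[0, +oo[ &, {homo a : x y / x <= y}} /\
        {in `[0, +oo[ &, {homo b : x y / x <= y}},
        a 0 = 0 /\ b 0 = 0 &
        forall z : 'cV[R]_n, z != 0 ->
          0 < a (norm2 z) /\ a (norm2 z) <= V z <= b (norm2 z)].

(* [traj] is the set of state trajectories, defined for t >= t0, of the system
   under consideration. *)
Definition lyapunov_function (R : realType) (n : nat) (t0 : R)
    (traj : set (R -> 'cV[R]_n)) (V : 'cV[R]_n -> R) : Prop :=
  pos_def_decrescent V /\
  forall z, traj z -> forall t : R, t0 <= t ->
    exists2 dV : R, is_deriv_from t0 (fun s => V (z s) : R^o) t dV & dV <= 0.

Definition output_error (R : realType) (N : nat) (thetastar : 'cV[R]_N)
    (phi theta : R -> 'cV[R]_N) (t : R) : R :=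
  dotv (theta t - thetastar) (phi t).

Definition normalizer (R : realType) (N : nat) (mu : R) (phi : R -> 'cV[R]_N)
    (t : R) : R :=
  1 + mu * dotv (phi t) (phi t).

Definition hot_solution (R : realType) (N : nat) (gamma beta mu t0 : R)
    (thetastar : 'cV[R]_N) (phi vartheta theta : R -> 'cV[R]_N) : Prop :=
  forall t : R, t0 <= t ->
    is_deriv_from t0 vartheta t
      (- (gamma * output_error thetastar phi theta t) *: phi t) /\
    is_deriv_from t0 theta t
      (- (beta * normalizer mu phi t) *: (theta t - vartheta t)).

Definition hot_state (R : realType) (N : nat) (thetastar : 'cV[R]_N)
    (vartheta theta : R -> 'cV[R]_N) (t : R) : 'cV[R]_(N + N) :=
  col_mx (vartheta t - thetastar) (theta t - vartheta t).

Definition hot_trajectories (R : realType) (N : nat) (gamma beta mu t0 : R)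
    (thetastar : 'cV[R]_N) (phi : R -> 'cV[R]_N) : set (R -> 'cV[R]_(N + N)) :=
  [set z | exists vartheta theta,
     hot_solution gamma beta mu t0 thetastar phi vartheta theta /\
     z = hot_state thetastar vartheta theta].

Definition hot_V (R : realType) (N : nat) (gamma : R) (z : 'cV[R]_(N + N)) : R :=
  gamma^-1 * norm2 (usubmx z) ^+ 2 + gamma^-1 * norm2 (dsubmx z) ^+ 2.

(* Main.v *)
(* Write a = vartheta - theta^*, b = theta - vartheta.  Since e_y = (a + b) . phi,
   the derivative of V along a solution is
     - 2 e_y^2 + 4 e_y (b . phi) - (2 beta / gamma) (1 + mu |phi|^2) |b|^2,
   and mu >= 2 gamma / beta turns the |phi|^2 |b|^2 term into at most
   - 4 |phi|^2 |b|^2, which completes the square after Cauchy-Schwarz.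
   For the limits, V is nonnegative and V' <= - c f^2 where f is e_y or a
   coordinate of b; f has a bounded derivative, so it cannot exceed e > 0 at
   arbitrarily late times without making V drop infinitely often by a fixed
   amount. *)
Require Import Defs.
From HB Require Import structures.
From mathcomp Require Import all_boot all_order all_algebra.
From mathcomp Require Import all_classical all_reals all_analysis.
From mathcomp Require Import ring lra.

Set Implicit Arguments.
Unset Strict Implicit.
Unset Printing Implicit Defensive.
Import Order.TTheory GRing.Theory Num.Theory.
Import numFieldNormedType.Exports.
Local Open Scope classical_set_scope.
Local Open Scope ring_scope.

(** * Dot product, 2-norm and Cauchy-Schwarz for column vectors *)

Section dot_product.
Context {R : realType} {n : nat}.
Implicit Types u v w : 'cV[R]_n.

Lemma dotvE u v : dotv u v = \sum_i u i 0 * v i 0.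
Proof. by rewrite /dotv mxE; apply: eq_bigr => i _; rewrite mxE. Qed.

Lemma dotvC u v : dotv u v = dotv v u.
Proof. by rewrite !dotvE; apply: eq_bigr => i _; rewrite mulrC. Qed.

Lemma dotvDl u v w : dotv (u + v) w = dotv u w + dotv v w.
Proof. by rewrite /dotv linearD mulmxDl mxE. Qed.

Lemma dotvZl a u v : dotv (a *: u) v = a * dotv u v.
Proof. by rewrite /dotv linearZ /= -scalemxAl mxE. Qed.

Lemma dotvBl u v w : dotv (u - v) w = dotv u w - dotv v w.
Proof. by rewrite dotvDl -scaleN1r dotvZl mulN1r. Qed.

Lemma dotvBr u v w : dotv w (u - v) = dotv w u - dotv w v.
Proof. by rewrite dotvC dotvBl !(dotvC w). Qed.

Lemma dotvZr a u v : dotv u (a *: v) = a * dotv u v.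
Proof. by rewrite dotvC dotvZl dotvC. Qed.

Lemma dotv_ge0 u : 0 <= dotv u u.
Proof. by rewrite dotvE sumr_ge0 // => i _; rewrite -expr2 sqr_ge0. Qed.

Lemma sqr_norm2 u : norm2 u ^+ 2 = dotv u u.
Proof. by rewrite sqr_sqrtr // dotv_ge0. Qed.

Lemma norm2_ge0 u : 0 <= norm2 u. Proof. exact: sqrtr_ge0. Qed.

Lemma sqr_coord_le_dotv u i : u i 0 ^+ 2 <= dotv u u.
Proof.
by rewrite dotvE (bigD1 i)//= expr2 lerDl sumr_ge0// => j _; rewrite -expr2 sqr_ge0.
Qed.

Lemma norm_coord_le_norm2 u i : `|u i 0| <= norm2 u.
Proof. by rewrite -sqrtr_sqr ler_sqrt ?dotv_ge0// sqr_coord_le_dotv. Qed.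

Lemma dotv_eq0 u : dotv u u = 0 -> u = 0.
Proof.
move=> u0; apply/matrixP => i j; rewrite ord1 mxE; apply/eqP.
by rewrite -sqrf_eq0 eq_le sqr_ge0 -u0 sqr_coord_le_dotv.
Qed.

Lemma norm2_gt0 u : u != 0 -> 0 < norm2 u.
Proof.
move=> u0; rewrite sqrtr_gt0 lt_def dotv_ge0 andbT.
by apply: contra_neq u0; exact: dotv_eq0.
Qed.

(* Cauchy-Schwarz: [0 <= |w|^2] for [w = (v . v) u - (u . v) v]. *)
Lemma dotv_le_norm2 u v : `|dotv u v| <= norm2 u * norm2 v.
Proof.
have [->|v0] := eqVneq v 0.
  by rewrite -(scale0r (0 : 'cV[R]_n)) dotvZr mul0r normr0 mulr_ge0 ?norm2_ge0.
rewrite -(@ler_pXn2r _ 2) ?nnegrE ?mulr_ge0 ?norm2_ge0//.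
rewrite real_normK ?num_real// exprMn !sqr_norm2.
have vv : 0 < dotv v v by rewrite -sqr_norm2 exprn_gt0 ?norm2_gt0.
have := dotv_ge0 (dotv v v *: u - dotv u v *: v).
rewrite dotvBl !dotvBr !dotvZl !dotvZr (dotvC v u) => h.
rewrite -subr_ge0 -(pmulr_rge0 _ vv); apply: le_trans h _.
by rewrite le_eqVlt; apply/orP; left; apply/eqP; ring.
Qed.

Lemma cvg_dotv {T : Type} {F : set_system T} {FF : Filter F}
    (f g : T -> 'cV[R]_n) u v :
  f @ F --> u -> g @ F --> v -> dotv (f x) (g x) @[x --> F] --> dotv u v.
Proof.
move=> fu gv; under eq_fun do rewrite dotvE.
rewrite dotvE; apply: cvg_big => [|i _]; first exact: add_continuous.
apply: cvgM.
- exact: cvg_comp _ _ fu (@coord_continuous _ _ _ i 0 u).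
- exact: cvg_comp _ _ gv (@coord_continuous _ _ _ i 0 v).
Qed.

End dot_product.

(** The topology on columns is that of the max norm over finitely many entries, so convergence may
    be checked entry by entry. This reduces the vector limits to scalar ones. *)
Lemma cvg_cV0 {R : realType} {n : nat} {T : Type} {F : set_system T}
    {FF : Filter F} (f : T -> 'cV[R]_n) :
  (forall i, f x i 0 @[x --> F] --> 0) -> f @ F --> (0 : 'cV[R]_n).
Proof.
move=> f0; apply/cvgr0Pnorm_lt => e e0.
have : \forall x \near F, forall i, `|f x i 0| < e.
  apply: filter_forall => i; move/cvgr0Pnorm_lt : (f0 i); exact.
apply: filterS => x fx; rewrite [`|_|]mx_normrE; apply: bigmax_lt => //= -[i j] _.
by rewrite ord1.
Qed.

(** * Calculus of derivatives on a closed half-line *)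

Section derivative_from.
Context {R : realType} {t0 : R}.

(** For [s != t], [f s] is [s - t] times the difference quotient, plus [f t]; the first factor
    vanishes in the limit while the quotient converges. *)
Lemma is_deriv_from_cvg (V : normedModType R) (f : R -> V) t l :
  is_deriv_from t0 f t l -> f s @[s --> within `[t0, +oo[ t^'] --> f t.
Proof.
move=> fl.
have st : (s - t) @[s --> within `[t0, +oo[ t^'] --> (0 : R).
  have tt : (fun s : R => s) @ within `[t0, +oo[ t^' --> t.
    exact: cvg_trans (cvg_within _) (@nbhs_dnbhs _ t).
  by rewrite -[X in _ --> X](subrr t); exact: (cvgB tt (cvg_cst t)).
rewrite -[X in _ --> X]add0r -(scale0r l).
apply: (cvg_trans _ (cvgD (cvgZ st fl) (cvg_cst (f t)))); apply: near_eq_cvg.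
near=> s.
have st0 : s - t != 0.
  rewrite subr_eq0; near: s; exact: (cvg_within (F := t^') _ (nbhs_dnbhs_neq t)).
suff E : (s - t) *: ((s - t)^-1 *: (f s - f t)) + f t = f s by exact: E.
by rewrite scalerA divff// scale1r subrK.
Unshelve. all: by end_near. Qed.

Lemma is_deriv_fromB (V : normedModType R) (f g : R -> V) t l m :
  is_deriv_from t0 f t l -> is_deriv_from t0 g t m ->
  is_deriv_from t0 (fun s => f s - g s) t (l - m).
Proof.
move=> fl gm; rewrite /is_deriv_from; apply: (cvg_trans _ (cvgB fl gm)).
apply: near_eq_cvg; near=> s.
suff E : (s - t)^-1 *: (f s - f t) - (s - t)^-1 *: (g s - g t) =
    (s - t)^-1 *: (f s - g s - (f t - g t)) by exact: E.
by rewrite -scalerBr !opprD !opprK addrACA.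
Unshelve. all: by end_near. Qed.

Lemma is_deriv_from_cst (V : normedModType R) (c : V) t :
  is_deriv_from t0 (fun=> c) t 0.
Proof.
rewrite /is_deriv_from; under eq_fun do rewrite subrr scaler0.
exact: cvg_cst.
Qed.

(** The quotient splits as (quotient of [f]) . [g s] + [f t] . (quotient of [g]), and [g s] tends to
    [g t] because [g] is differentiable. *)
Lemma is_deriv_from_dotv {n} (f g : R -> 'cV[R]_n) t l m :
  is_deriv_from t0 f t l -> is_deriv_from t0 g t m ->
  is_deriv_from t0 (fun s => dotv (f s) (g s) : R^o) t
    (dotv l (g t) + dotv (f t) m).
Proof.
move=> fl gm.
apply: (cvg_trans _ (cvgD (cvg_dotv fl (is_deriv_from_cvg gm))
  (cvg_dotv (cvg_cst (f t)) gm)));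
  apply: near_eq_cvg; near=> s.
suff E : dotv ((s - t)^-1 *: (f s - f t)) (g s) +
    dotv (f t) ((s - t)^-1 *: (g s - g t)) =
    (s - t)^-1 * (dotv (f s) (g s) - dotv (f t) (g t)) by exact: E.
by rewrite dotvZl dotvZr dotvBl dotvBr; ring.
Unshelve. all: by end_near. Qed.

Lemma is_deriv_from_coord {n} (f : R -> 'cV[R]_n) t l i :
  is_deriv_from t0 f t l -> is_deriv_from t0 (fun s => f s i 0 : R^o) t (l i 0).
Proof.
move=> fl; apply: (cvg_trans _ (cvg_comp _ _ fl (@coord_continuous _ _ _ i 0 l))).
by apply: near_eq_cvg; near=> s; rewrite /= !mxE.
Unshelve. all: by end_near. Qed.

Lemma is_deriv_fromD (V : normedModType R) (f g : R -> V) t l m :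
  is_deriv_from t0 f t l -> is_deriv_from t0 g t m ->
  is_deriv_from t0 (fun s => f s + g s) t (l + m).
Proof.
move=> fl gm; have := is_deriv_fromB fl (is_deriv_fromB (is_deriv_from_cst 0 t) gm).
by under eq_fun do rewrite sub0r opprK; rewrite sub0r opprK.
Qed.

Lemma is_deriv_fromZ (V : normedModType R) (f : R -> V) c t l :
  is_deriv_from t0 f t l -> is_deriv_from t0 (fun s => c *: f s) t (c *: l).
Proof.
move=> fl; rewrite /is_deriv_from; apply: (cvg_trans _ (cvgZl_tmp (k := c) fl)).
apply: near_eq_cvg; near=> s.
suff E : c *: ((s - t)^-1 *: (f s - f t)) = (s - t)^-1 *: (c *: f s - c *: f t).
  by exact: E.
by rewrite -scalerBr !scalerA mulrC.
Unshelve. all: by end_near. Qed.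

(** Continuity passes to any finer filter [G]; the use below is the right neighbourhoods of the left
    end point of an interval. *)
Lemma is_deriv_from_cvg_subfilter (V : normedModType R) (f : R -> V) t l
    (G : set_system R) :
  within `[t0, +oo[ t^' `<=` G -> is_deriv_from t0 f t l -> f @ G --> f t.
Proof. by move=> sG /is_deriv_from_cvg; apply: cvg_trans => A /= fA; exact: sG. Qed.

(** When [t0 < t], the constraint [t0 <= s] holds for all [s] close to [t], so the half-line
    derivative is two-sided there. The rest is the change of variable [s = h + t]. *)
Lemma is_deriv_from_is_derive (f : R -> R^o) t l :
  t0 < t -> is_deriv_from t0 f t l -> is_derive t (1 : R) f l.
Proof.
move=> t0t fl.
suff fl0 : h^-1 *: (f (h *: (1 : R) + t) - f t) @[h --> 0^'] --> l.
  by apply: DeriveDef; [apply/cvg_ex; exists l | exact: cvg_lim fl0].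
have ht : (h + t) @[h --> 0^'] --> within `[t0, +oo[ t^'.
  move=> A; rewrite /within/= /dnbhs /within/= => tA.
  have {}tA : \forall x \near t, x != t -> A x.
    near=> x; have t0x : t0 < x by near: x; exact: lt_nbhsr.
    have tAx : x != t -> [set` `[t0, +oo[] x -> A x by near: x.
    by move=> /tAx; apply; rewrite /= in_itv/= andbT ltW.
  move/nbhs0P : tA; apply: filterS => h hA h0; rewrite /= addrC; apply: hA.
  by rewrite -subr_eq0 addrAC subrr add0r.
apply: (cvg_trans _ (cvg_comp _ _ ht fl)); apply: near_eq_cvg; near=> h.
suff E : (h + t - t)^-1 *: (f (h + t) - f t) =
    h^-1 *: (f (h *: (1 : R) + t) - f t) by exact: E.
by rewrite addrK -[_ *: 1]/(_ * 1) mulr1.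
Unshelve. all: by end_near. Qed.

(** Points of the open interval lie beyond [t0], so [f] has an ordinary derivative there. At [a],
    which may be [t0], the half-line derivative yields the right continuity that the mean value
    theorem asks for. *)
Lemma MVT_from (f df : R -> R^o) a b :
  (forall t, t0 <= t -> is_deriv_from t0 f t (df t)) -> t0 <= a -> a < b ->
  exists2 c, a < c < b & f b - f a = df c * (b - a).
Proof.
move=> fdf t0a ab.
have fd x : a < x -> is_derive x (1 : R) f (df x).
  move=> ax; apply: is_deriv_from_is_derive; first exact: le_lt_trans ax.
  by apply: fdf; rewrite (le_trans t0a) ?ltW.
have [| |c] := @MVT R f df a b ab; last by rewrite in_itv; exists c.
  by move=> x /[!in_itv]/= /andP[ax _]; exact: fd.
have fc x : a < x -> {for x, continuous f}.
  by move=> ax; apply/differentiable_continuous/derivable1_diffP; case: (fd x ax).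
apply/continuous_within_itvP => //; split.
- by move=> x /[!in_itv]/= /andP[ax _]; exact: fc.
- apply: (is_deriv_from_cvg_subfilter _ (fdf a t0a)) => A.
  rewrite /at_right /within/= /dnbhs /within/= => aA.
  apply: (@filterS _ (nbhs a) _ _ _ _ aA) => x xA ax.
  by apply: xA; [rewrite gt_eqF | rewrite in_itv/= andbT (le_trans t0a) ?ltW].
- by apply: cvg_at_left_filter; exact: fc.
Qed.

Lemma le_from (f df : R -> R^o) a b :
  (forall t, t0 <= t -> is_deriv_from t0 f t (df t)) ->
  (forall t, t0 <= t -> df t <= 0) -> t0 <= a -> a <= b -> f b <= f a.
Proof.
move=> fdf df0 t0a; rewrite le_eqVlt => /predU1P[->//|ab].
have [c /andP[ac _] fE] := MVT_from fdf t0a ab.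
rewrite -subr_le0 fE mulr_le0_ge0 ?subr_ge0 ?(ltW ab)//.
by rewrite df0// (le_trans t0a)// ltW.
Qed.

(* Barbalat's argument: each time [t] with [e <= |f t|] forces [V] to drop by
   the fixed amount [eta] over [[t, t + d]], whereas [V] comes within [eta] of
   its infimum. *)
Lemma cvg0_dissipation (V dV f df : R -> R^o) c M : 0 < c ->
  (forall t, t0 <= t -> is_deriv_from t0 V t (dV t)) ->
  (forall t, t0 <= t -> 0 <= V t) ->
  (forall t, t0 <= t -> dV t <= - (c * f t ^+ 2)) ->
  (forall t, t0 <= t -> is_deriv_from t0 f t (df t)) ->
  (forall t, t0 <= t -> `|df t| <= M) ->
  f t @[t --> +oo] --> (0 : R).
Proof.
move=> c0 VdV V0 dVf fdf dfM; apply/cvgr0Pnorm_lt => e e0.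
have L0 : 0 < 1 + `|M| by rewrite ltr_pwDl.
(* During a time [d], [f] moves by at most [(1 + |M|) * d = e / 2]. Adding 1 keeps the divisor
   positive even if [M] is 0. *)
pose d := e / 2 / (1 + `|M|).
have d0 : 0 < d by rewrite !divr_gt0.
(* While [|f|] is at least [e / 2], [V] decreases at rate at least [c * (e / 2) ^+ 2]; [eta] is the
   resulting loss over a time [d]. *)
pose eta := c * (e / 2) ^+ 2 * d.
have eta0 : 0 < eta by rewrite !mulr_gt0 ?exprn_gt0 ?divr_gt0.
have infV : has_inf [set V t | t in `[t0, +oo[].
  split; first by exists (V t0), t0 => //=; rewrite in_itv/= lexx.
  by exists 0 => _ [t /= /[!in_itv]/= /andP[t0t _] <-]; exact: V0.
have [_ [T /= /[!in_itv]/= /andP[t0T _] <-] VT] := inf_adherent eta0 infV.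
near=> t.
have Tt : T <= t by near: t; apply: nbhs_pinfty_ge; exact: num_real.
have t0t : t0 <= t := le_trans t0T Tt.
rewrite ltNge; apply/negP => eft.
have Vt : V t <= V T.
  by apply: (le_from VdV) => // s t0s; apply: le_trans (dVf _ t0s) _;
    rewrite oppr_le0 mulr_ge0 ?sqr_ge0// ltW.
have tdt : t < t + d by rewrite ltrDl.
(* The mean value theorem replaces integration of [dV]: the lower bound on [|f|] is required only at
   [c1], and a second application between [t] and [c1] provides it. *)
have [c1 /andP[tc1 c1d] VE] := MVT_from VdV t0t tdt.
have t0c1 : t0 <= c1 by rewrite (le_trans t0t)// ltW.
have [c2 /andP[tc2 _] fE] := MVT_from fdf t0t tc1.
have t0c2 : t0 <= c2 by rewrite (le_trans t0t)// ltW.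
have fc1t : `|f c1 - f t| <= e / 2.
  rewrite fE normrM (gtr0_norm (x := c1 - t)) ?subr_gt0//.
  apply: (@le_trans _ _ ((1 + `|M|) * d)); last by rewrite /d mulrC divfK// gt_eqF.
  apply: ler_pM => //; first by rewrite subr_ge0 ltW.
    by apply: le_trans (dfM _ t0c2) _; rewrite (le_trans (ler_norm M))// lerDr.
  by rewrite lerBlDl ltW.
have fc1 : e / 2 <= `|f c1|.
  have := ler_distD (f c1) (f t) 0; rewrite !subr0 distrC => h.
  by have := le_trans eft h; lra.
have fc1sqr : (e / 2) ^+ 2 <= f c1 ^+ 2.
  rewrite -[leRHS](real_normK (num_real _)) ler_pXn2r ?nnegrE// ltW//.
  by rewrite divr_gt0.
have Vdrop : V (t + d) - V t <= - eta.
  rewrite VE addrAC subrr add0r /eta -mulNr ler_pM2r//.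
  by apply: le_trans (dVf _ t0c1) _; rewrite lerN2 ler_pM2l.
(* [V t <= V T] lies less than [eta] above the infimum, so the drop would push [V (t + d)] below
   it. *)
have : inf [set V t | t in `[t0, +oo[] <= V (t + d).
  apply: ge_inf; first by case: infV.
  by exists (t + d) => //=; rewrite in_itv/= andbT (le_trans t0t)// ltW.
by lra.
Unshelve. all: by end_near. Qed.

(** * Bounded scalar functions on a half-line and their closure properties *)

Definition bounded_from (f : R -> R) := exists M, forall t, t0 <= t -> `|f t| <= M.

Lemma bounded_from_cst c : bounded_from (fun=> c).
Proof. by exists `|c|. Qed.

Lemma bounded_fromD f g :
  bounded_from f -> bounded_from g -> bounded_from (fun t => f t + g t).
Proof.
move=> [M fM] [P gP]; exists (M + P) => t t0t.
by rewrite (le_trans (ler_normD _ _))// lerD ?fM ?gP.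
Qed.

Lemma bounded_fromM f g :
  bounded_from f -> bounded_from g -> bounded_from (fun t => f t * g t).
Proof.
move=> [M fM] [P gP]; exists (M * P) => t t0t.
by rewrite normrM ler_pM ?fM ?gP.
Qed.

Lemma bounded_fromN f : bounded_from f -> bounded_from (fun t => - f t).
Proof. by move=> [M fM]; exists M => t t0t; rewrite normrN fM. Qed.

Lemma cvg0_bounded_fromM (f g : R -> R) :
  f t @[t --> +oo] --> (0 : R) -> bounded_from g ->
  (f t * g t) @[t --> +oo] --> (0 : R).
Proof.
move=> /cvgr0Pnorm_lt f0 [M gM]; apply/cvgr0Pnorm_lt => e e0.
have L0 : 0 < 1 + `|M| by rewrite ltr_pwDl.
near=> t.
have t0t : t0 <= t by near: t; apply: nbhs_pinfty_ge; exact: num_real.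
have ft : `|f t| < e / (1 + `|M|) by near: t; apply: f0; rewrite divr_gt0.
rewrite normrM (@le_lt_trans _ _ (`|f t| * (1 + `|M|)))// -?ltr_pdivlMr//.
rewrite ler_wpM2l// (le_trans (gM _ t0t))// (le_trans (ler_norm M))// lerDr//.
Unshelve. all: by end_near. Qed.

Lemma LinftyP {n} (f : R -> 'cV[R]_n) :
  Linfty t0 f <-> exists M, forall t, t0 <= t -> norm2 (f t) <= M.
Proof.
split=> [[M fM]|[M fM]]; exists M.
  by move=> t t0t; apply: fM; exists t => //=; rewrite in_itv/= t0t.
by move=> _ [t /= /[!in_itv]/= /andP[t0t _] <-]; exact: fM.
Qed.

Lemma bounded_from_dotv {n} (f g : R -> 'cV[R]_n) :
  Linfty t0 f -> Linfty t0 g -> bounded_from (fun t => dotv (f t) (g t)).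
Proof.
move=> /LinftyP[M fM] /LinftyP[P gP]; exists (M * P) => t t0t.
by rewrite (le_trans (dotv_le_norm2 _ _))// ler_pM ?norm2_ge0 ?fM ?gP.
Qed.

Lemma bounded_from_coord {n} (f : R -> 'cV[R]_n) i :
  Linfty t0 f -> bounded_from (fun t => f t i 0).
Proof.
move=> /LinftyP[M fM]; exists M => t t0t.
by rewrite (le_trans (norm_coord_le_norm2 _ _))// fM.
Qed.

End derivative_from.

(** * The Lyapunov function as a function of the state *)

Lemma hot_V_state (R : realType) N (gamma : R) (thetastar : 'cV[R]_N)
    (vartheta theta : R -> 'cV[R]_N) t :
  hot_V gamma (hot_state thetastar vartheta theta t) =
  gamma^-1 * dotv (vartheta t - thetastar) (vartheta t - thetastar) +
  gamma^-1 * dotv (theta t - vartheta t) (theta t - vartheta t).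
Proof. by rewrite /hot_V /hot_state col_mxKu col_mxKd !sqr_norm2. Qed.

(** The squared 2-norm is additive over the two stacked blocks. Hence [hot_V] depends on [z] through
    its norm alone, which makes the comparison functions immediate. *)
Lemma hot_V_norm2 (R : realType) N (gamma : R) (z : 'cV[R]_(N + N)) :
  hot_V gamma z = gamma^-1 * norm2 z ^+ 2.
Proof.
rewrite /hot_V -mulrDr !sqr_norm2; congr (_ * _).
by rewrite -[in RHS](vsubmxK z) [RHS]/dotv tr_col_mx mul_row_col mxE.
Qed.

Lemma hot_V_pos_def_decrescent (R : realType) N (gamma : R) :
  0 < gamma -> pos_def_decrescent (@hot_V R N gamma).
Proof.
move=> gamma0; split.
  by rewrite hot_V_norm2 sqr_norm2 -(scale0r (0 : 'cV_(N + N))) dotvZl mul0r mulr0.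
(* Since [hot_V gamma z] equals [a (norm2 z)], the same [a] serves as lower and upper comparison
   function. *)
pose a (x : R) := gamma^-1 * x ^+ 2.
have ac : continuous a.
  by move=> x; apply: cvgM; [exact: cvg_cst | exact: exprn_continuous].
have aH : {in `[0, +oo[ &, {homo a : x y / x <= y}}.
  move=> x y /[!in_itv]/= /andP[x0 _] /andP[y0 _] xy.
  by rewrite /a ler_pM2l ?invr_gt0// ler_pXn2r.
have a0 : a 0 = 0 by rewrite /a expr0n/= mulr0.
exists a, a; split=> //; first by split; exact: continuous_subspaceT.
move=> z z0; rewrite hot_V_norm2 /a lexx; split=> //.
by rewrite mulr_gt0 ?invr_gt0// exprn_gt0// norm2_gt0.
Qed.

(** * Dissipation and boundedness along a solution *)

Section hot_solution.
Context {R : realType} {N : nat} {gamma beta mu t0 : R}.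
Context {thetastar : 'cV[R]_N} {phi vartheta theta : R -> 'cV[R]_N}.
Hypotheses (gamma_gt0 : 0 < gamma) (beta_gt0 : 0 < beta).
Hypothesis mu_ge : 2 * gamma / beta <= mu.
Hypothesis sol : hot_solution gamma beta mu t0 thetastar phi vartheta theta.

Let a t : 'cV[R]_N := vartheta t - thetastar.
Let b t : 'cV[R]_N := theta t - vartheta t.
Let ey := output_error thetastar phi theta.
Let dvartheta t : 'cV[R]_N := - (gamma * ey t) *: phi t.
Let dtheta t : 'cV[R]_N := - (beta * normalizer mu phi t) *: b t.

Let V t : R^o := hot_V gamma (hot_state thetastar vartheta theta t).

(** The right-hand sides of the algorithm are already substituted for the derivatives, so the
    estimates on [hot_dV] are pure algebra and hold at every [t]; the constraint [t0 <= t] enters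
    only when [hot_dV] is identified as the derivative of [V]. *)
Definition hot_dV t : R :=
  gamma^-1 * (2 * dotv (dvartheta t) (a t)) +
  gamma^-1 * (2 * dotv (dtheta t - dvartheta t) (b t)).

Definition hot_bound t : R :=
  - (2 * beta / gamma) * norm2 (b t) ^+ 2 - `|ey t| ^+ 2
  - (`|ey t| - 2 * norm2 (b t) * norm2 (phi t)) ^+ 2.

Lemma is_deriv_from_subcst (f : R -> 'cV[R]_N) c t l :
  is_deriv_from t0 f t l -> is_deriv_from t0 (fun s => f s - c) t l.
Proof.
by move=> fl; rewrite -[l]subr0; exact: is_deriv_fromB fl (is_deriv_from_cst c t).
Qed.

Lemma is_deriv_from_hot_V t : t0 <= t -> is_deriv_from t0 V t (hot_dV t).
Proof.
move=> /sol [dv dt].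
have da := is_deriv_from_subcst thetastar dv.
have db := is_deriv_fromB dt dv.
rewrite /V; under eq_fun do rewrite hot_V_state.
have -> : hot_dV t =
    gamma^-1 * (dotv (dvartheta t) (a t) + dotv (a t) (dvartheta t)) +
    gamma^-1 * (dotv (dtheta t - dvartheta t) (b t) +
                dotv (b t) (dtheta t - dvartheta t)).
  by rewrite (dotvC (a t)) (dotvC (b t)) /hot_dV; ring.
exact: is_deriv_fromD (is_deriv_fromZ (c := gamma^-1) (is_deriv_from_dotv da da))
  (is_deriv_fromZ (c := gamma^-1) (is_deriv_from_dotv db db)).
Qed.

Lemma output_errorE t : ey t = dotv (a t) (phi t) + dotv (b t) (phi t).
Proof. by rewrite -dotvDl addrC /a /b addrA subrK. Qed.

Lemma hot_dV_le t : hot_dV t <= hot_bound t.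
Proof.
rewrite /hot_dV /hot_bound dotvBl !dotvZl !(dotvC (phi t)).
have eyE := output_errorE t.
have cs : ey t * dotv (b t) (phi t) <= `|ey t| * (norm2 (b t) * norm2 (phi t)).
  by rewrite (le_trans (ler_norm _))// normrM ler_wpM2l// dotv_le_norm2.
(* The first factor is nonnegative exactly when [2 * gamma / beta <= mu]. *)
have gap : 0 <= (gamma^-1 * (mu * beta) - 2) * (dotv (phi t) (phi t) * dotv (b t) (b t)).
  rewrite mulr_ge0 ?mulr_ge0 ?dotv_ge0// subr_ge0 ler_pdivlMl// mulrC.
  by rewrite -ler_pdivrMr.
rewrite /normalizer real_normK ?num_real// -subr_ge0.
set q := dotv (b t) (phi t) in eyE cs *.
have -> : dotv (a t) (phi t) = ey t - q by rewrite eyE addrK.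
(* Once a . phi is eliminated as [ey t - q], bound minus derivative is exactly four times the slack
   in [cs] plus twice the quantity in [gap]. *)
rewrite [X in 0 <= X](_ : _ =
  4 * (`|ey t| * (norm2 (b t) * norm2 (phi t)) - ey t * q)
  + 2 * ((gamma^-1 * (mu * beta) - 2) * (dotv (phi t) (phi t) * dotv (b t) (b t)))).
  by rewrite addr_ge0// mulr_ge0// subr_ge0.
rewrite sqrrB real_normK ?num_real// !exprMn !sqr_norm2.
by field; rewrite gt_eqF.
Qed.

(** The factor 1 gives the shape [- (c * f t ^+ 2)] expected by [cvg0_dissipation]; the two other
    terms of the bound are nonpositive. *)
Lemma hot_bound_le_ey t : hot_bound t <= - (1 * ey t ^+ 2).
Proof.
rewrite /hot_bound real_normK ?num_real// mul1r.
have : 0 <= 2 * beta / gamma * norm2 (b t) ^+ 2.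
  by rewrite mulr_ge0 ?sqr_ge0// divr_ge0 ?mulr_ge0 ?ltW.
have := sqr_ge0 (`|ey t| - 2 * norm2 (b t) * norm2 (phi t)).
by lra.
Qed.

(** Stated for one coordinate because [cvg0_dissipation] treats scalar functions. *)
Lemma hot_bound_le_coord t i :
  hot_bound t <= - (2 * beta / gamma * b t i 0 ^+ 2).
Proof.
have : 2 * beta / gamma * b t i 0 ^+ 2 <= 2 * beta / gamma * norm2 (b t) ^+ 2.
  apply: ler_wpM2l; first by rewrite divr_ge0 ?mulr_ge0 ?ltW.
  by rewrite sqr_norm2 sqr_coord_le_dotv.
have := sqr_ge0 (`|ey t| - 2 * norm2 (b t) * norm2 (phi t)).
have := sqr_ge0 `|ey t|.
by rewrite /hot_bound; lra.
Qed.

Lemma hot_bound_le0 t : hot_bound t <= 0.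
Proof. by rewrite (le_trans (hot_bound_le_ey t))// mul1r oppr_le0 sqr_ge0. Qed.

Lemma hot_dV_le0 t : hot_dV t <= 0.
Proof. exact: le_trans (hot_dV_le t) (hot_bound_le0 t). Qed.

Lemma hot_V_ge0 t : 0 <= V t.
Proof. by rewrite /V hot_V_norm2 mulr_ge0 ?sqr_ge0// invr_ge0 ltW. Qed.

Lemma hot_V_le t : t0 <= t -> V t <= V t0.
Proof.
move=> t0t; apply: le_from is_deriv_from_hot_V _ (lexx _) t0t => s _.
exact: hot_dV_le0.
Qed.

(** As [V] never exceeds its initial value, [f] stays in the ball of radius
    [Num.sqrt (gamma * V t0)]. It is applied to the two summands of [V]. *)
Lemma Linfty_hot (f : R -> 'cV[R]_N) :
  (forall t, gamma^-1 * dotv (f t) (f t) <= V t) -> Linfty t0 f.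
Proof.
move=> fV; apply/LinftyP; exists (Num.sqrt (gamma * V t0)) => t t0t.
rewrite ler_wsqrtr// -ler_pdivrMl//.
exact: le_trans (fV t) (hot_V_le t0t).
Qed.

Lemma Linfty_vartheta : Linfty t0 a.
Proof.
apply: Linfty_hot => t; rewrite /V hot_V_state lerDl.
by rewrite mulr_ge0 ?dotv_ge0// invr_ge0 ltW.
Qed.

Lemma Linfty_theta : Linfty t0 b.
Proof.
apply: Linfty_hot => t; rewrite /V hot_V_state lerDr.
by rewrite mulr_ge0 ?dotv_ge0// invr_ge0 ltW.
Qed.

(** * Limits under a bounded feature *)

Section bounded_feature.
Hypothesis phi_bounded : Linfty t0 phi.

Lemma bounded_from_normalizer : bounded_from (t0 := t0) (normalizer mu phi).
Proof.
apply: bounded_fromD; first exact: bounded_from_cst.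
by apply: bounded_fromM; [exact: bounded_from_cst | exact: bounded_from_dotv].
Qed.

Lemma bounded_from_output_error : bounded_from (t0 := t0) ey.
Proof.
rewrite (funext output_errorE).
by apply: bounded_fromD; apply: bounded_from_dotv => //;
  [exact: Linfty_vartheta | exact: Linfty_theta].
Qed.

Lemma bounded_from_gain :
  bounded_from (t0 := t0) (fun t => - (beta * normalizer mu phi t)).
Proof.
apply: bounded_fromN; apply: bounded_fromM; first exact: bounded_from_cst.
exact: bounded_from_normalizer.
Qed.

Lemma bounded_from_gamma_phi i :
  bounded_from (t0 := t0) (fun t => - gamma * phi t i 0).
Proof.
by apply: bounded_fromM; [exact: bounded_from_cst | exact: bounded_from_coord].
Qed.

(** Each coordinate of [b] is dissipated at rate [2 * beta / gamma], and its derivative is a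
    polynomial in bounded quantities: the normalizer, [b], [ey] and [phi]. *)
Lemma cvg_theta_sub_vartheta : b t @[t --> +oo] --> (0 : 'cV[R]_N).
Proof.
apply: cvg_cV0 => i.
have [M dbM] : bounded_from (t0 := t0)
    (fun t => - (beta * normalizer mu phi t) * b t i 0 +
      - (ey t * (- gamma * phi t i 0))).
  apply: bounded_fromD.
    apply: bounded_fromM; first exact: bounded_from_gain.
    exact: bounded_from_coord Linfty_theta.
  apply: bounded_fromN; apply: bounded_fromM; first exact: bounded_from_output_error.
  exact: bounded_from_gamma_phi.
apply: (@cvg0_dissipation _ t0 V hot_dV _ (fun t => (dtheta t - dvartheta t) i 0)
  (2 * beta / gamma) M).
- by rewrite divr_gt0 ?mulr_gt0.
- exact: is_deriv_from_hot_V.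
- by move=> t _; exact: hot_V_ge0.
- by move=> t _; exact: le_trans (hot_dV_le t) (hot_bound_le_coord t i).
- move=> t /sol[dv dt]; apply: is_deriv_from_coord.
  exact: is_deriv_fromB dt dv.
- move=> t /dbM; rewrite !mxE; congr (`| _ + - _| <= _).
  by rewrite mulrCA mulrA mulNr.
Qed.

Lemma cvg_output_error (dphi : R -> 'cV[R]_N) :
  (forall t, t0 <= t -> is_deriv_from t0 phi t (dphi t)) -> Linfty t0 dphi ->
  ey t @[t --> +oo] --> (0 : R).
Proof.
move=> phid dphi_bounded.
have [M deyM] : bounded_from (t0 := t0) (fun t =>
    - (beta * normalizer mu phi t) * dotv (b t) (phi t) +
    (dotv (a t) (dphi t) + dotv (b t) (dphi t))).
  apply: bounded_fromD.
    apply: bounded_fromM; first exact: bounded_from_gain.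
    exact: bounded_from_dotv Linfty_theta phi_bounded.
  by apply: bounded_fromD; apply: bounded_from_dotv => //;
    [exact: Linfty_vartheta | exact: Linfty_theta].
apply: (@cvg0_dissipation _ t0 V hot_dV _
  (fun t => dotv (dtheta t) (phi t) + dotv (theta t - thetastar) (dphi t)) 1 M) => //.
- exact: is_deriv_from_hot_V.
- by move=> t _; exact: hot_V_ge0.
- by move=> t _; exact: le_trans (hot_dV_le t) (hot_bound_le_ey t).
- move=> t t0t; have [_ dt] := sol t0t; apply: is_deriv_from_dotv (phid t t0t).
  exact: is_deriv_from_subcst.
- move=> t /deyM; rewrite -dotvDl dotvZl; congr (`| _ + dotv _ _| <= _).
  by rewrite addrC /a /b addrA subrK.
Qed.

(** Coordinatewise, the right-hand side of the equation is [ey] times a bounded factor. *)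
Lemma cvg_dvartheta : ey t @[t --> +oo] --> (0 : R) ->
  dvartheta t @[t --> +oo] --> (0 : 'cV[R]_N).
Proof.
move=> ey0; apply: cvg_cV0 => i.
have -> : (fun t => dvartheta t i 0) = (fun t => ey t * (- gamma * phi t i 0)).
  by apply/funext => t; rewrite mxE; ring.
exact: cvg0_bounded_fromM ey0 (bounded_from_gamma_phi i).
Qed.

Lemma cvg_dtheta : dtheta t @[t --> +oo] --> (0 : 'cV[R]_N).
Proof.
apply: cvg_cV0 => i.
have b0 : b t i 0 @[t --> +oo] --> (0 : R).
  have <- : (0 : 'cV[R]_N) i 0 = 0 by rewrite mxE.
  exact: cvg_comp _ _ cvg_theta_sub_vartheta (@coord_continuous _ _ _ i 0 _).
have -> : (fun t => dtheta t i 0) =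
    (fun t => b t i 0 * - (beta * normalizer mu phi t)).
  by apply/funext => t; rewrite mxE mulrC.
exact: cvg0_bounded_fromM b0 bounded_from_gain.
Qed.

End bounded_feature.
End hot_solution.

Theorem theorem1 (R : realType) (N : nat) (gamma beta mu t0 : R)
    (gamma_gt0 : 0 < gamma) (beta_gt0 : 0 < beta) (mu_gt0 : 0 < mu)
    (mu_ge : 2 * gamma / beta <= mu)
    (thetastar : 'cV[R]_N) (phi : R -> 'cV[R]_N) :
  lyapunov_function t0 (hot_trajectories gamma beta mu t0 thetastar phi)
    (hot_V gamma)
  /\
  forall vartheta theta : R -> 'cV[R]_N,
    hot_solution gamma beta mu t0 thetastar phi vartheta theta ->
    let ey := output_error thetastar phi theta in
    [/\ forall t : R, t0 <= t ->
          let bound := - (2 * beta / gamma) * norm2 (theta t - vartheta t) ^+ 2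
                       - `|ey t| ^+ 2
                       - (`|ey t|
                          - 2 * norm2 (theta t - vartheta t) * norm2 (phi t)) ^+ 2 in
          exists dV : R,
            [/\ is_deriv_from t0
                  (fun s => hot_V gamma (hot_state thetastar vartheta theta s) : R^o)
                  t dV,
                dV <= bound &
                bound <= 0],
        Linfty t0 (fun t => vartheta t - thetastar),
        Linfty t0 (fun t => theta t - vartheta t) &
        Linfty t0 phi ->
        (exists2 dphi : R -> 'cV[R]_N,
           forall t : R, t0 <= t -> is_deriv_from t0 phi t (dphi t) &
           Linfty t0 dphi) ->
        [/\ ey t @[t --> +oo] --> 0,
            (theta t - vartheta t) @[t --> +oo] --> (0 : 'cV[R]_N),
            exists2 dvartheta : R -> 'cV[R]_N,
              forall t : R, t0 <= t -> is_deriv_from t0 vartheta t (dvartheta t) &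
              dvartheta t @[t --> +oo] --> (0 : 'cV[R]_N) &
            exists2 dthetatilde : R -> 'cV[R]_N,
              forall t : R, t0 <= t ->
                is_deriv_from t0 (fun s => theta s - thetastar) t (dthetatilde t) &
              dthetatilde t @[t --> +oo] --> (0 : 'cV[R]_N)]].
Proof.
split.
  split; first exact: hot_V_pos_def_decrescent.
  move=> _ [vartheta [theta [sol ->]]] t t0t.
  exists (hot_dV (gamma := gamma) (beta := beta) (mu := mu)
    (thetastar := thetastar) (phi := phi) (vartheta := vartheta) (theta := theta) t).
    exact: is_deriv_from_hot_V.
  exact: hot_dV_le0.
move=> vartheta theta sol ey; split.
- move=> t t0t; exists (hot_dV (gamma := gamma) (beta := beta) (mu := mu)
    (thetastar := thetastar) (phi := phi) (vartheta := vartheta) (theta := theta) t).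
  split; first exact: is_deriv_from_hot_V.
    exact: hot_dV_le.
  exact: hot_bound_le0.
- exact: Linfty_vartheta sol.
- exact: Linfty_theta sol.
- move=> phi_bounded [dphi phid dphi_bounded].
  have ey0 : ey t @[t --> +oo] --> (0 : R).
    exact: cvg_output_error sol phi_bounded _ phid dphi_bounded.
  split=> //.
  + exact: cvg_theta_sub_vartheta sol phi_bounded.
  + exists (fun t => - (gamma * ey t) *: phi t); first by move=> t /sol[].
    exact: cvg_dvartheta phi_bounded ey0.
  (* Subtracting the constant [thetastar] leaves the derivative of [theta] unchanged, so the
     right-hand side of its equation is the witness. *)
  + exists (fun t => - (beta * normalizer mu phi t) *: (theta t - vartheta t)).
      by move=> t /sol[_ dt]; exact: is_deriv_from_subcst.
    exact: cvg_dtheta sol phi_bounded.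
Qed.
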